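(* The following hold. (1) Every finitely generated LERF group is solitary. (2) If $G$ is a countable group such that $\mathrm{Sub}(G)$ is countable, then $G$ is solitary. (3) Let $1\to N\to H\to G\to 1$ be a short exact sequence of countable groups such that $N$ is finitely generated (as an abstract group). If $H$ is solitary then so is $G$. (4) Let $G$ and $H$ be countable groups. The free product $G*H$ is solitary if and only if one of the following two options holds: (a) both $G$ and $H$ are LERF and finitely generated; (b) $G$ is solitary and $H$ is trivial, or vice versa ($H$ is solitary and $G$ is trivial).
   Context: For a countable group $G$, $\mathrm{Sub}(G)$ is the set of all subgroups of $G$ with the Chabauty topology, i.e. the topology induced from the product topology on $\{0,1\}^G$. A countable group $G$ is called solitary if the set of isolated points of $\mathrm{Sub}(G)$ is dense in $\mathrm{Sub}(G)$. A group is LERF (subgroup separable) if each of its finitely generated subgroups is an intersection of finite index subgroups. *)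

(* Defs.v *)
From HB Require Import structures.
From mathcomp Require Import all_boot all_classical.
From mathcomp Require Import topology.

Set Implicit Arguments.
Unset Strict Implicit.
Unset Printing Implicit Defensive.

Local Open Scope classical_set_scope.
Local Open Scope group_scope.

(* A subgroup is given by its indicator function, i.e. a point of {0,1}^G.
   Through the coercion [set_type], [Subgroups G] is also a type, which the library
   equips with the topology induced from the product topology. *)
Definition Subgroups (G : groupType) : set (prod_topology (fun _ : G => bool)) :=
  [set S | group_closed (S : {pred G})].
Arguments Subgroups G : clear implicits.

Definition carrier (G : groupType) (K : Subgroups G) : set G := [set g | set_val K g].

Definition solitary (G : groupType) : Prop :=
  countable [set: G] /\ dense (isolated [set: Subgroups G]).

Definition generated_by (G : groupType) (s : seq G) : set G :=
  \bigcap_(K in [set K : Subgroups G | [set` s] `<=` carrier K]) carrier K.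

Definition fin_gen_subgroup (G : groupType) (K : Subgroups G) : Prop :=
  exists s : seq G, carrier K = generated_by s.

Definition fin_gen (G : groupType) : Prop :=
  exists s : seq G, generated_by s = [set: G].

Definition finite_index (G : groupType) (K : Subgroups G) : Prop :=
  finite_set [set [set g * k | k in carrier K] | g in [set: G]].

Definition LERF (G : groupType) : Prop :=
  forall K : Subgroups G, fin_gen_subgroup K ->
    exists F : set (Subgroups G), (forall L, F L -> finite_index L) /\
      carrier K = \bigcap_(L in F) carrier L.

Definition short_exact (N H G : groupType)
    (i : {multiplicative N -> H}) (p : {multiplicative H -> G}) : Prop :=
  [/\ injective i, range i = [set h | p h = 1] & range p = [set: G]].

Definition trivial_group (G : groupType) : Prop := forall x : G, x = 1.

(* The free product, realised as the set of reduced words: alternating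
   sequences of nontrivial letters from the two factors. *)
Section FreeProduct.
Variables G H : groupType.
Implicit Types (x y : G + H) (u v w : seq (G + H)).

Definition letter_trivial x : bool :=
  match x with inl g => g == 1 | inr h => h == 1 end.

Definition letter_inv x : G + H :=
  match x with inl g => inl g^-1 | inr h => inr h^-1 end.

Definition other_factor x y : bool :=
  match x, y with inl _, inr _ | inr _, inl _ => true | _, _ => false end.

Definition reduced w : bool :=
  all (predC letter_trivial) w && sorted other_factor w.

(* The product of the letter x and the reduced word w, again reduced. *)
Definition push x w : seq (G + H) :=
  if letter_trivial x then w else
  match x, w with
  | inl g, inl g' :: w' => if g * g' == 1 then w' else inl (g * g') :: w'
  | inr h, inr h' :: w' => if h * h' == 1 then w' else inr (h * h') :: w'
  | _, _ => x :: w
  end.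

Definition word_mul u v : seq (G + H) := foldr push v u.
Definition word_inv u : seq (G + H) := rev (map letter_inv u).

Lemma other_factor_sym : symmetric other_factor.
Proof. by case=> ? []. Qed.

Lemma reduced_behead x w : reduced (x :: w) -> reduced w.
Proof. by rewrite /reduced /= => /andP[/andP[_ ->] /path_sorted ->]. Qed.

Lemma reduced_push x w : reduced w -> reduced (push x w).
Proof.
rewrite /push; case: ifP => // xN1 rw.
case: x xN1 => a /= aN1; case: w rw => [|[b|b] w] rw.
- by rewrite /reduced /= aN1.
- case: ifP => [_|abN1]; first exact: reduced_behead rw.
  move: rw; rewrite /reduced /= abN1 => /andP[/andP[_ ->]].
  by case: w => [|[]].
- by move: rw; rewrite /reduced /= aN1 => /andP[-> ->].
- by rewrite /reduced /= aN1.
- by move: rw; rewrite /reduced /= aN1 => /andP[-> ->].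
- case: ifP => [_|abN1]; first exact: reduced_behead rw.
  move: rw; rewrite /reduced /= abN1 => /andP[/andP[_ ->]].
  by case: w => [|[]].
Qed.

Lemma reduced_mul u v : reduced v -> reduced (word_mul u v).
Proof. by move=> rv; elim: u => //= x u; apply: reduced_push. Qed.

Lemma reduced_inv u : reduced u -> reduced (word_inv u).
Proof.
move=> /andP[u1 us]; apply/andP; split.
  by rewrite all_rev all_map; apply: sub_all u1 => -[] a /=; rewrite invg_eq1.
rewrite /word_inv rev_sorted sorted_map; apply: sub_sorted us.
by move=> [] a [] b.
Qed.

Lemma push_cons x w : reduced (x :: w) -> push x w = x :: w.
Proof.
rewrite /push /reduced /= => /andP[/andP[/negPf-> _]].
by case: x w => a [|[] b w].
Qed.

Lemma pushVK x w : reduced (x :: w) -> push (letter_inv x) (x :: w) = w.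
Proof.
rewrite /push /reduced /= => /andP[/andP[x1 _] _].
by case: x x1 => a /negPf; rewrite /= invg_eq1 => ->; rewrite mulVg eqxx.
Qed.

Lemma push_inlM (a b : G) w : reduced w ->
  push (inl a) (push (inl b) w) = push (inl (a * b)) w.
Proof.
case: (eqVneq b 1) => [->|b1]; first by rewrite mulg1 {2}/push /= eqxx.
case: (eqVneq a 1) => [->|a1]; first by rewrite mul1g {1}/push /= eqxx.
case: w => [|[c|c] w] rw; rewrite [push (inl b) _]/push /= (negPf b1).
- by rewrite /push /= (negPf a1).
- have c1 : c != 1 by case/andP: rw => /= /andP[].
  have ra : reduced (inl a :: w).
    by move: rw; rewrite /reduced /= a1 => /andP[/andP[_ ->]]; case: w => [|[]].
  case: (eqVneq (b * c) 1) => [bc1|bc1].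
    rewrite push_cons // /push /= -mulgA bc1 mulg1 (negPf a1).
    case: eqP => // ab1; have -> // : a = c.
    by rewrite -[a]mulg1 -bc1 mulgA ab1 mul1g.
  rewrite /push /= (negPf a1) mulgA.
  by case: (eqVneq (a * b) 1) => [->|//]; rewrite mul1g (negPf c1).
- by rewrite /push /= (negPf a1).
Qed.

Lemma push_inrM (a b : H) w : reduced w ->
  push (inr a) (push (inr b) w) = push (inr (a * b)) w.
Proof.
case: (eqVneq b 1) => [->|b1]; first by rewrite mulg1 {2}/push /= eqxx.
case: (eqVneq a 1) => [->|a1]; first by rewrite mul1g {1}/push /= eqxx.
case: w => [|[c|c] w] rw; rewrite [push (inr b) _]/push /= (negPf b1).
- by rewrite /push /= (negPf a1).
- by rewrite /push /= (negPf a1).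
- have c1 : c != 1 by case/andP: rw => /= /andP[].
  have ra : reduced (inr a :: w).
    by move: rw; rewrite /reduced /= a1 => /andP[/andP[_ ->]]; case: w => [|[]].
  case: (eqVneq (b * c) 1) => [bc1|bc1].
    rewrite push_cons // /push /= -mulgA bc1 mulg1 (negPf a1).
    case: eqP => // ab1; have -> // : a = c.
    by rewrite -[a]mulg1 -bc1 mulgA ab1 mul1g.
  rewrite /push /= (negPf a1) mulgA.
  by case: (eqVneq (a * b) 1) => [->|//]; rewrite mul1g (negPf c1).
Qed.

Lemma word_mul_push x v w : reduced v -> reduced w ->
  word_mul (push x v) w = push x (word_mul v w).
Proof.
move=> rv rw; rewrite {1}/push.
case: ifP => x1; first by rewrite [RHS]/push x1.
case: x x1 => a x1; case: v rv => [|[] b v] rv //=.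
- have rm := reduced_mul v rw; rewrite push_inlM //.
  by case: ifP => // ab1; rewrite /push /= ab1.
- have rm := reduced_mul v rw; rewrite push_inrM //.
  by case: ifP => // ab1; rewrite /push /= ab1.
Qed.

Lemma word_mulA u v w : reduced v -> reduced w ->
  word_mul u (word_mul v w) = word_mul (word_mul u v) w.
Proof.
move=> rv rw; elim: u => //= x u ->.
by rewrite -/(word_mul u v) word_mul_push // reduced_mul.
Qed.

Lemma word_mul1 u : reduced u -> word_mul u [::] = u.
Proof.
elim: u => //= x u IHu rxu.
by rewrite -/(word_mul u [::]) IHu ?push_cons //; apply: reduced_behead rxu.
Qed.

Lemma word_mulV u : reduced u -> word_mul (word_inv u) u = [::].
Proof.
elim: u => // x u IHu rxu.
rewrite /word_inv /word_mul /= rev_cons foldr_rcons pushVK //.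
by apply: IHu; apply: reduced_behead rxu.
Qed.

Lemma word_invK : involutive word_inv.
Proof.
by move=> u; rewrite /word_inv map_rev revK mapK // => -[] a /=; rewrite invgK.
Qed.

Record free_product := FreeProduct {
  fp_word :> seq (G + H);
  fp_reduced : reduced fp_word }.

HB.instance Definition _ := [isSub for fp_word].
HB.instance Definition _ := [Choice of free_product by <:].

Definition fp_one : free_product := @FreeProduct [::] isT.
Definition fp_mul (p q : free_product) : free_product :=
  FreeProduct (reduced_mul p (fp_reduced q)).
Definition fp_inv (p : free_product) : free_product :=
  FreeProduct (reduced_inv (fp_reduced p)).

Fact fp_mulA : associative fp_mul.
Proof. by move=> p q r; apply/val_inj/word_mulA; apply: fp_reduced. Qed.
Fact fp_mul1g : left_id fp_one fp_mul.
Proof. by move=> p; apply: val_inj. Qed.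
Fact fp_mulg1 : right_id fp_one fp_mul.
Proof. by move=> p; apply/val_inj/word_mul1/fp_reduced. Qed.
Fact fp_mulVg : left_inverse fp_one fp_inv fp_mul.
Proof. by move=> p; apply/val_inj/word_mulV/fp_reduced. Qed.
Fact fp_mulgV : right_inverse fp_one fp_inv fp_mul.
Proof.
move=> p; apply: val_inj; rewrite /= -{1}[fp_word p]word_invK.
by apply/word_mulV/reduced_inv/fp_reduced.
Qed.

HB.instance Definition _ := isGroup.Build free_product
  fp_mulA fp_mul1g fp_mulg1 fp_mulVg fp_mulgV.

Definition fp_letter x : free_product :=
  FreeProduct (reduced_push x (isT : reduced [::])).

Lemma fp_cons x w (rxw : reduced (x :: w)) :
  FreeProduct rxw = fp_letter x * FreeProduct (reduced_behead rxw).
Proof.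
have rw := reduced_behead rxw.
by apply: val_inj; rewrite /= word_mul_push //= push_cons.
Qed.

Lemma fp_letterM :
  {morph (fun g : G => fp_letter (inl g)) : a b / a * b} /\
  {morph (fun h : H => fp_letter (inr h)) : a b / a * b}.
Proof.
by split=> a b; apply: val_inj;
  rewrite /= word_mul_push ?reduced_push //= ?push_inlM ?push_inrM.
Qed.

(* Universal property: [free_product], with the letter maps
   [fp_letter \o inl] and [fp_letter \o inr], is the coproduct of G and H. *)
Lemma fp_universal (K : groupType)
    (f : {multiplicative G -> K}) (f' : {multiplicative H -> K}) :
  exists phi : {multiplicative free_product -> K},
    [/\ forall g, phi (fp_letter (inl g)) = f g,
        forall h, phi (fp_letter (inr h)) = f' h &
        forall psi : {multiplicative free_product -> K},
          (forall g, psi (fp_letter (inl g)) = f g) ->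
          (forall h, psi (fp_letter (inr h)) = f' h) -> psi =1 phi].
Proof.
have mul1 (L : groupType) (k : {multiplicative L -> K}) : k 1 = 1.
  by apply: (mulgI (k 1)); rewrite -gmulfM !mulg1.
pose ev x := match x with inl g => f g | inr h => f' h end.
pose evw w := foldr (fun x k => ev x * k) 1 w.
have ev_push x w : evw (push x w) = ev x * evw w.
  rewrite /push; case: ifP => [|_].
    by case: x => a /= /eqP->; rewrite mul1 mul1g.
  case: x w => a [|[] b w] //=; case: ifP => [/eqP ab1|_] /=;
    by rewrite mulgA -gmulfM // ab1 mul1 mul1g.
have phiM : {morph (evw \o fp_word) : p q / p * q}.
  move=> [u ru] [v rv] /=; elim: u {ru} => [|x u IHu] /=; first by rewrite mul1g.
  by rewrite ev_push IHu mulgA.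
pose phi : {multiplicative free_product -> K} :=
  HB.pack (evw \o fp_word) (isMultiplicative.Build _ _ _ phiM).
have phi_letter x : phi (fp_letter x) = ev x.
  by rewrite /phi /= ev_push /= mulg1.
exists phi; split=> [g|h|psi psil psir [w rw]]; rewrite ?phi_letter //.
elim: w rw => [|x w IHw] rw.
  by have -> : FreeProduct rw = 1 :> free_product; [apply: val_inj | rewrite !mul1].
by rewrite fp_cons !gmulfM IHw phi_letter; case: x rw => a rw; rewrite ?psil ?psir.
Qed.
End FreeProduct.

(* Main.v *)
Require Import Defs.
From HB Require Import structures.
From mathcomp Require Import all_boot all_classical.
From mathcomp Require Import topology.

Set Implicit Arguments.
Unset Strict Implicit.
Unset Printing Implicit Defensive.

Local Open Scope classical_set_scope.
Local Open Scope group_scope.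

(* A finite index subgroup of a finitely generated group is isolated: it is
   finitely generated (Schreier), and a subgroup containing it that avoids
   representatives of its nontrivial cosets equals it.  This gives (1).

   For (4), if both factors are nontrivial then an isolated subgroup K of
   F = G * H has finite index.  Otherwise the F-set K\F is infinite, so some edge,
   labelled say by a letter of G, leaves the finite set of points that decides
   membership of K in its isolating neighbourhood, and ends at a point q.
   Transposing q with a point z of an arbitrary disjoint H-set changes the
   H-action at q only, and the new stabiliser of the base point still lies in that
   neighbourhood, hence is K.  Whether K contains a given conjugate of h is then
   decided by whether h fixes z, which is absurd: it does if z is a fixed point, and
   it does not, for h <> 1, if z = 1 in the regular H-set.  Hence solitude of F
   provides enough finite index subgroups to make G and H LERF and finitely
   generated.  The converse is (1) together with the theorem of Burns and Romanovskii
   that free products of LERF groups are LERF. *)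

(** * Subgroups, spans, and cylinders as a base of the Chabauty topology *)

Section Subgroups.
Variable G : groupType.
Implicit Types (K L : Subgroups G) (a b : set G).

Lemma carrier1 K : carrier K 1.
Proof. by case: (set_mem (valP K)). Qed.

Lemma carrierF K x y : carrier K x -> carrier K y -> carrier K (x / y).
Proof. by case: (set_mem (valP K)) => _; apply. Qed.

Lemma carrierV K x : carrier K x -> carrier K x^-1.
Proof. by move=> Kx; rewrite -div1g; apply: carrierF => //; apply: carrier1. Qed.

Lemma carrierM K x y : carrier K x -> carrier K y -> carrier K (x * y).
Proof.
by move=> Kx Ky; rewrite -[y]invgK; apply: carrierF => //; apply: carrierV.
Qed.

Lemma carrier_inj : injective (@carrier G).
Proof.
move=> K L KL; apply: val_inj; apply: funext => g /=.
by apply/idP/idP; rewrite -![is_true _]/(carrier _ g) KL.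
Qed.

Lemma subgroup_of_set (A : set G) : A 1 ->
  (forall x y, A x -> A y -> A (x / y)) -> exists K, carrier K = A.
Proof.
move=> A1 AF; pose S : prod_topology (fun _ : G => bool) := fun g => `[< A g >].
have SP : Subgroups G S.
  split; first exact/asboolP.
  by move=> x y /asboolP Ax /asboolP Ay; apply/asboolP; apply: AF.
exists (exist _ S (mem_set SP)); apply/funext => g.
by rewrite /carrier /= set_valE /=; apply/propext; split => /asboolP.
Qed.

(** Takes sets where [generated_by] takes lists, so that generating sets can be formed by unions and
    images. *)
Definition span a : set G :=
  \bigcap_(K in [set K : Subgroups G | a `<=` carrier K]) carrier K.

Lemma span_subgroup a : exists K, carrier K = span a.
Proof.
apply: subgroup_of_set => [K _|x y ax ay K aK]; first exact: carrier1.
by apply: carrierF; [apply: ax | apply: ay].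
Qed.

Lemma sub_span a : a `<=` span a.
Proof. by move=> x ax K /(_ _ ax). Qed.

Lemma span_sub a K : a `<=` carrier K -> span a `<=` carrier K.
Proof. by move=> aK x; apply. Qed.

(** For finite [a] and [b] these are the basic open sets of the Chabauty topology. *)
Definition cylinder a b : set (Subgroups G) :=
  [set K | a `<=` carrier K /\ b `<=` ~` carrier K].

Lemma nbhs_cylinder a b K : finite_set a -> finite_set b ->
  cylinder a b K -> nbhs K (cylinder a b).
Proof.
have coord g (c : bool) L : set_val L g = c -> nbhs L [set M | set_val M g = c].
  move=> Lg.
  have cg : set_val M g @[M --> L] --> set_val L g.
    apply: (@cvg_comp _ _ _ set_val (fun S => S g) _ (nbhs (set_val L))).
      exact: (@initial_continuous (Subgroups G : choiceType)
                (prod_topology (fun _ : G => bool)) set_val L).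
    exact: (@proj_continuous G (fun=> bool) g).
  by apply: (cg [set c]); rewrite Lg; apply: discrete_set1.
move=> /finite_fsetP[X ->] /finite_fsetP[Y ->] [aK bK]; apply: filterI.
  apply: (@filter_bigI _ _ X (fun g => [set L | set_val L g = true])) => g gX.
  by apply: coord; apply: aK.
apply: filterS (@filter_bigI _ _ Y (fun g => [set L | set_val L g = false]) (nbhs K) _ _).
  by move=> L LY g gY; rewrite /carrier /= LY.
by move=> g gY; apply: coord; apply/negP; apply: bK.
Qed.

(** The cylinders around [K] generate a filter [F]. It converges to [K] in the product, since a
    single constraint fixes a coordinate, so every neighbourhood contains a cylinder. *)
Lemma nbhs_cylinder_sub K (A : set (Subgroups G)) : nbhs K A ->
  exists a b, [/\ finite_set a, finite_set b, cylinder a b K & cylinder a b `<=` A].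
Proof.
pose F := filter_from
  [set ab : set G * set G | [/\ finite_set ab.1, finite_set ab.2 & cylinder ab.1 ab.2 K]]
  (fun ab => cylinder ab.1 ab.2).
have FF : Filter F.
  apply: filter_from_filter; first by exists (set0, set0); repeat split => //; exact: sub0set.
  move=> [a b] [a' b'] /= [fa fb [aK bK]] [fa' fb' [aK' bK']].
  exists (a `|` a', b `|` b').
    by split; rewrite /= ?finite_setU //; split; rewrite subUset.
  by move=> L [/=]; rewrite !subUset => -[? ?] [? ?].
have cvF : set_val @ F --> (set_val K : prod_topology (fun _ : G => bool)).
  apply/cvg_sup => g U [V] [[W] oW <-] WK WU.
  have F1 : F [set L | set_val L g = set_val K g].
    exists (if set_val K g then ([set g], set0) else (set0, [set g])) => /=.
      case Kg: (set_val K g); split => //=; split=> x //= ->; rewrite /carrier /= Kg //.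
    case Kg: (set_val K g) => L [/= aL bL]; first exact: aL.
    by apply/negP; apply: bL.
  by apply: filterS F1 => L /= LK; apply: WU; rewrite /= LK.
move=> [B [[W oW <-] WK WA]].
have [[a b] /= [fa fb abK] abW] : F (set_val @^-1` W).
  by apply: cvF; apply: open_nbhs_nbhs.
by exists a, b; split => // L /abW/WA.
Qed.

Definition cyl_isolated K := exists a b,
  [/\ finite_set a, finite_set b, cylinder a b K &
      forall L, cylinder a b L -> L = K].

Lemma isolatedP K : isolated [set: Subgroups G] K <-> cyl_isolated K.
Proof.
split=> [[_ [V VK VE]]|[a [b [fa fb abK abE]]]].
  have [a [b [fa fb abK abV]]] := nbhs_cylinder_sub VK.
  exists a, b; split=> // L /abV VL.
  by have : (V `&` setT) L by []; rewrite VE.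
split; first exact/mem_set.
exists (cylinder a b); first exact: nbhs_cylinder.
by rewrite setIT; apply/seteqP; split=> [L /abE //|L ->].
Qed.

Lemma solitaryP : solitary G <-> countable [set: G] /\
  forall a b, finite_set a -> finite_set b -> cylinder a b !=set0 ->
    exists2 K, cylinder a b K & cyl_isolated K.
Proof.
split=> -[cG dG]; split=> //.
  move=> a b fa fb [K abK].
  have [L [abL /isolatedP isoL]] : (cylinder a b)° `&` isolated setT !=set0.
    apply: dG; last exact: open_interior.
    by exists K; apply: nbhs_cylinder.
  by exists L => //; apply: interior_subset abL.
move=> O [K OK] oO.
have [a [b [fa fb abK abO]]] := nbhs_cylinder_sub (open_nbhs_nbhs (conj oO OK)).
have [L abL isoL] := dG _ _ fa fb (ex_intro _ _ abK).
by exists L; split; [apply: abO | apply/isolatedP].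
Qed.

End Subgroups.

(** * Finite index subgroups: separation, Schreier generators, isolation *)

Section FiniteIndex.
Variable G : groupType.
Implicit Types (K L : Subgroups G) (a b : set G).

Lemma fin_genP : fin_gen G <-> exists2 a, finite_set a & span a = [set: G].
Proof.
split=> [[s sG]|[a /finite_seqP[s ->] aG]]; last by exists s.
by exists [set` s]; first exact: finite_seq.
Qed.

Definition lcoset (K : Subgroups G) (g : G) : set G := [set g * k | k in carrier K].

Lemma lcosetP K g h : lcoset K g h <-> carrier K (g^-1 * h).
Proof.
split=> [[k Kk <-]|Kgh]; first by rewrite mulKg.
by exists (g^-1 * h) => //; rewrite mulVKg.
Qed.

Lemma eq_lcoset K g h : lcoset K g = lcoset K h <-> carrier K (g^-1 * h).
Proof.
split=> [gh|Kgh].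
  by apply/lcosetP; rewrite gh; apply/lcosetP; rewrite mulVg; apply: carrier1.
apply/seteqP; split=> x /lcosetP Kx; apply/lcosetP.
  have := carrierM (carrierV Kgh) Kx.
  by rewrite invgM invgK -mulgA mulVKg.
by have := carrierM Kgh Kx; rewrite -mulgA mulVKg.
Qed.

(** Each fibre of [f] lies in a single coset, so a coset is recovered from the value of [f] at any
    of its elements. *)
Lemma finite_index_fibres T (f : G -> T) K : finite_set (range f) ->
  (forall g h, f g = f h -> carrier K (g^-1 * h)) -> finite_index K.
Proof.
move=> ff fK.
apply: (@sub_finite_set _ _ ((fun t => lcoset K (xget 1 [set g | f g = t])) @` range f)).
  move=> _ [g _ <-]; exists (f g); first by exists g.
  apply/eq_lcoset; apply: fK.
  by apply: (@xgetPex _ 1 [set h | f h = f g]); exists g.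
exact: finite_image.
Qed.

Lemma finite_indexI K L : finite_index K -> finite_index L ->
  exists2 M, finite_index M & carrier M = carrier K `&` carrier L.
Proof.
move=> fK fL.
have [M ME] : exists M, carrier M = carrier K `&` carrier L.
  apply: subgroup_of_set => [|x y [Kx Lx] [Ky Ly]]; first by split; apply: carrier1.
  by split; apply: carrierF.
exists M => //.
apply: (@finite_index_fibres _ (fun g => (lcoset K g, lcoset L g))).
  apply: sub_finite_set (finite_setX fK fL) => _ [g _ <-].
  by split; exists g.
by move=> g h [] /eq_lcoset Kgh /eq_lcoset Lgh; rewrite ME.
Qed.

(** For each element of [b], LERF yields a finite index subgroup that contains [a] and misses that
    element; these are intersected, starting from the whole group. *)
Lemma LERF_separate a b : LERF G -> finite_set a -> finite_set b ->
  b `<=` ~` span a -> exists2 L, finite_index L & cylinder a b L.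
Proof.
move=> lG fa /finite_seqP[s ->].
have [A AE] := span_subgroup a.
have [F [Ffin FE]] : exists F : set (Subgroups G),
    (forall L, F L -> finite_index L) /\ carrier A = \bigcap_(L in F) carrier L.
  by apply: lG; have /finite_seqP[t aE] := fa; exists t; rewrite AE aE.
have aF L : F L -> a `<=` carrier L.
  move=> FL x ax; have : carrier A x by rewrite AE; apply: sub_span.
  by rewrite FE; apply.
elim: s => [|g s IHs] sA.
  have [T TE] : exists T : Subgroups G, carrier T = setT by exact: subgroup_of_set.
  exists T; last by split=> //; rewrite TE.
  apply: (@finite_index_fibres _ (fun=> tt)); last by rewrite TE.
  by apply: sub_finite_set (finite_set1 tt) => -[] _.
have [|L fL [aL sL]] := IHs.
  by move=> x xs; apply: sA; rewrite /= inE [x \in s]xs orbT.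
have [M FM Mg] : exists2 M, F M & ~ carrier M g.
  have : ~ span a g by apply: sA; rewrite /= inE eqxx.
  by rewrite -AE FE => /existsNP[M] /not_implyP[]; exists M.
have [N fN NE] := finite_indexI fL (Ffin _ FM).
exists N => //; split; rewrite NE; first by rewrite subsetI; split=> //; apply: aF.
move=> x; rewrite /= inE => /orP[/eqP-> [] // | xs [Lx _]].
exact: sL xs Lx.
Qed.

Lemma LERF_of_separate :
  (forall a g, finite_set a -> ~ span a g ->
    exists L, [/\ finite_index L, a `<=` carrier L & ~ carrier L g]) -> LERF G.
Proof.
move=> sep K [s Ks].
exists [set L | finite_index L /\ carrier K `<=` carrier L]; split; first by move=> L [].
apply/seteqP; split=> [x Kx L [_]|x Lx]; first exact.
apply: contrapT; rewrite Ks => nx.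
have [L [fL sL]] := sep [set` s] x (finite_seq s) nx; apply.
by apply: Lx; split=> //; rewrite Ks; apply: span_sub.
Qed.

(** Chosen from the coset alone, so that equal cosets share their representative. *)
Definition coset_rep K g : G := xget 1 (lcoset K g).

Lemma coset_repP K g : carrier K (g^-1 * coset_rep K g).
Proof.
apply/lcosetP; apply: xgetPex; exists g.
by apply/lcosetP; rewrite mulVg; apply: carrier1.
Qed.

Lemma coset_rep_eq K g h : carrier K (g^-1 * h) -> coset_rep K g = coset_rep K h.
Proof. by move/eq_lcoset; rewrite /coset_rep => ->. Qed.

Lemma finite_coset_rep K : finite_index K -> finite_set (range (coset_rep K)).
Proof.
move=> /(finite_image (xget 1)); apply: sub_finite_set => _ [g _ <-].
by exists (lcoset K g); first by exists g.
Qed.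

(* Schreier's lemma *)
Lemma finite_index_fin_gen K : fin_gen G -> finite_index K ->
  exists2 a, finite_set a & carrier K = span a.
Proof.
move=> /fin_genP[S fS SG] fK; pose rep := coset_rep K.
have frep : finite_set (range rep) by exact: finite_coset_rep.
pose Y := [set (rep (s * t))^-1 * (s * t) | s in S & t in range rep].
(* [Y] consists of the Schreier generators; [rep 1] is added because the representative of the
   trivial coset need not be [1]. *)
exists (Y `|` [set rep 1]).
  by rewrite finite_setU; split; [apply: finite_image2 | apply: finite_set1].
have Krep g : carrier K ((rep g)^-1 * g).
  by have := carrierV (coset_repP K g); rewrite invgM invgK.
have K1 : carrier K (rep 1) by have := coset_repP K 1; rewrite invg1 mul1g.
have rep_rep d g : rep (d * rep g) = rep (d * g).
  by apply: coset_rep_eq; rewrite invgM -mulgA mulKg; apply: Krep.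
apply/seteqP; split=> [k Kk M YM|]; last first.
  have YK : Y `|` [set rep 1] `<=` carrier K.
    by move=> _ [[s _ [t _ <-]]|->] //; apply: Krep.
  exact: span_sub.
have MY s t : S s -> range rep t -> carrier M ((rep (s * t))^-1 * (s * t)).
  by move=> Ss tr; apply: YM; left; exists s => //; exists t.
have M1 : carrier M (rep 1) by apply: YM; right.
(* [D] collects the elements whose Schreier elements at all cosets lie in [M]. It is a subgroup
   containing [S], hence everything. *)
have [D DE] : exists D : Subgroups G,
    carrier D = [set d | forall g, carrier M ((rep (d * rep g))^-1 * (d * rep g))].
  apply: subgroup_of_set => [g|d e Dd De g].
    rewrite mul1g; have := rep_rep 1 g; rewrite !mul1g => ->.
    by rewrite mulVg; apply: carrier1.
  (* Evaluating both conditions at [e^-1 * g] makes the inner representatives cancel in the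
     product. *)
  have Me := carrierV (De (e^-1 * g)).
  have Md := Dd (e^-1 * g).
  move: Me; rewrite !rep_rep mulVKg => Me; rewrite -mulgA.
  rewrite rep_rep in Md.
  by have := carrierM Md Me; rewrite !invgM invgK -!mulgA mulVKg.
have Dall d : carrier D d.
  have : span S d by rewrite SG.
  by apply=> s Ss; rewrite DE => g; apply: MY => //; exists g.
(* For [k] in [K], the Schreier element at the trivial coset is [k] conjugated by [rep 1], itself an
   element of [M]. *)
have := Dall k; rewrite DE => /(_ 1).
have -> : rep (k * rep 1) = rep 1.
  by rewrite rep_rep mulg1; apply/esym/coset_rep_eq; rewrite invg1 mul1g.
move=> Mk; have := carrierF (carrierM M1 Mk) M1.
by rewrite mulVKg mulgK.
Qed.

Lemma finite_index_isolated K : fin_gen G -> finite_index K -> cyl_isolated K.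
Proof.
move=> fG fK; have [a fa Ka] := finite_index_fin_gen fG fK.
exists a, (range (coset_rep K) `\` carrier K); split=> //.
- by apply: finite_setD; apply: finite_coset_rep.
- by split=> [|x []] //; rewrite Ka; apply: sub_span.
move=> L [aL bL]; apply: carrier_inj; apply/seteqP; split; last first.
  by rewrite Ka; apply: span_sub.
move=> x Lx; apply: contrapT => nKx.
have KL : carrier K `<=` carrier L by rewrite Ka; apply: span_sub.
apply: (bL (coset_rep K x)); last first.
  by have := carrierM Lx (KL _ (coset_repP K x)); rewrite mulVKg.
split; first by exists x.
move=> Kr; apply: nKx.
by have := carrierF Kr (coset_repP K x); rewrite invgM invgK mulVKg.
Qed.

(** Being contained in [K], the subgroup [span a] avoids [b]; it thus lies in the isolating cylinder
    and equals [K]. *)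
Lemma cyl_isolated_fin_gen K : cyl_isolated K ->
  exists2 a, finite_set a & carrier K = span a.
Proof.
move=> [a [b [fa fb [aK bK] abE]]]; exists a => //.
have [A AE] := span_subgroup a; rewrite -AE; congr carrier.
apply/esym/abE; split; rewrite AE; first exact: sub_span.
by move=> x /bK nKx ax; apply: nKx; apply: span_sub ax.
Qed.

Lemma fin_gen_of_finite_index K a : finite_index K -> finite_set a ->
  carrier K = span a -> fin_gen G.
Proof.
move=> fK fa Ka; apply/fin_genP.
exists (a `|` range (coset_rep K)).
  by rewrite finite_setU; split=> //; apply: finite_coset_rep.
apply/seteqP; split=> // g _ M; rewrite /= subUset => -[aM rM].
have KM : carrier K `<=` carrier M by rewrite Ka; apply: span_sub.
have Mr : carrier M (coset_rep K g) by apply: rM; exists g.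
have := carrierF Mr (KM _ (coset_repP K g)).
by rewrite invgM invgK mulVKg.
Qed.

End FiniteIndex.

(** * Images and preimages of subgroups; quotients of solitary groups *)

Section Morphisms.
Variables (H G : groupType) (p : H -> G).
Hypothesis pM : {morph p : x y / x * y}.

Lemma morph_one : p 1 = 1.
Proof. by apply: (mulgI (p 1)); rewrite -pM !mulg1. Qed.

Lemma morph_inv x : p x^-1 = (p x)^-1.
Proof. by apply: (mulgI (p x)); rewrite -pM !mulgV morph_one. Qed.

Lemma morph_div x y : p (x / y) = p x / p y.
Proof. by rewrite pM morph_inv. Qed.

Lemma preimage_subgroup (K : Subgroups G) :
  exists L : Subgroups H, carrier L = p @^-1` carrier K.
Proof.
apply: subgroup_of_set => [|x y Kx Ky]; rewrite /preimage /=.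
  by rewrite morph_one; apply: carrier1.
by rewrite morph_div; apply: carrierF.
Qed.

Lemma image_subgroup (K : Subgroups H) :
  exists L : Subgroups G, carrier L = p @` carrier K.
Proof.
apply: subgroup_of_set => [|_ _ [x Kx <-] [y Ky <-]].
  by exists 1; [apply: carrier1 | apply: morph_one].
by exists (x / y); [apply: carrierF | apply: morph_div].
Qed.

Lemma fin_gen_image : range p = [set: G] -> fin_gen H -> fin_gen G.
Proof.
move=> psurj /fin_genP[a fa aH]; apply/fin_genP.
exists (p @` a); first exact: finite_image.
apply/seteqP; split=> // g _ K aK.
have [L LE] := preimage_subgroup K.
have [h _ <-] : range p g by rewrite psurj.
have : carrier L h.
  have : span a h by rewrite aH.
  by apply=> x ax; rewrite LE; apply: aK; exists x.
by rewrite LE.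
Qed.

(** Subgroups of [H] containing [n] contain the kernel, so preimages identify Sub(G) with the open
    set of these subgroups. Cylinders are transported by [p] and by a section [s] of it. For an
    isomorphism [n] can be empty. *)
Lemma solitary_quotient (n : set H) : range p = [set: G] -> countable [set: G] ->
  finite_set n -> (forall x, n x -> p x = 1) ->
  (forall K : Subgroups H, n `<=` carrier K -> forall x, p x = 1 -> carrier K x) ->
  solitary H -> solitary G.
Proof.
move=> psurj cG fn n1 nker /solitaryP[_ dH]; apply/solitaryP; split=> //.
move=> a b fa fb [K [aK bK]].
have ps g : exists h, p h = g.
  by have [h _ <-] : range p g by [rewrite psurj]; exists h.
have [s sP] := choice ps.
have [P PE] := preimage_subgroup K.
have fa' : finite_set (n `|` s @` a) by rewrite finite_setU; split=> //; apply: finite_image.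
have [|L [aL bL] [a' [b' [fa2 fb2 [aL' bL'] abE]]]] :=
    dH _ (s @` b) fa' (finite_image s fb).
  exists P; split; rewrite PE.
    move=> x /= [nx|[y ay <-]]; rewrite /preimage /=; last by rewrite sP; apply: aK.
    by rewrite n1 //; apply: carrier1.
  by move=> _ [y by_ <-]; rewrite /preimage /= sP; apply: bK.
have nL : n `<=` carrier L by move=> x nx; apply: aL; left.
have [Q QE] := image_subgroup L.
(* [L] contains the kernel, so it is the full preimage of [Q]. *)
have QL x : carrier Q (p x) -> carrier L x.
  rewrite QE => -[y Ly /esym pxy].
  have := carrierM (nker L nL (x / y) _) Ly; rewrite mulgVK; apply.
  by rewrite morph_div pxy mulgV.
exists Q; first split.
- by move=> x ax; rewrite QE; exists (s x); rewrite ?sP //; apply: aL; right; exists x.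
- move=> x bx; rewrite -[x]sP => /QL; exact: (bL (s x) (ex_intro2 _ _ x bx erefl)).
exists (p @` a'), (p @` b'); split; try exact: finite_image.
  split; first by rewrite QE => _ [x ax <-]; exists x => //; apply: aL'.
  by move=> _ [x bx <-] /QL; apply: bL'.
move=> M [aM bM]; apply: carrier_inj; have [R RE] := preimage_subgroup M.
have RL : R = L.
  apply: abE; rewrite /cylinder /= RE; split=> x h /=; first by apply: aM; exists x.
  by apply: bM; exists x.
rewrite QE -RL RE; apply/seteqP; split=> [g Mg|_ [x Mx <-] //].
by exists (s g); rewrite /preimage /= sP.
Qed.

End Morphisms.

(** * Solitude of finitely generated LERF groups, of groups with countably many subgroups, and of
    quotients *)

Lemma fin_gen_countable (G : groupType) : fin_gen G -> countable [set: G].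
Proof.
move=> [s sG].
(* The boolean marks inversion; an index out of range gives the harmless letter [1]. *)
pose letter (c : bool * nat) := let g := nth 1 s c.2 in if c.1 then g^-1 else g.
pose f (w : seq (bool * nat)) : G := foldr (fun c g => letter c * g) 1 w.
have fM u v : f (u ++ v) = f u * f v.
  by elim: u => [|c u IHu] /=; rewrite ?mul1g // IHu mulgA.
have fV u : exists v, f v = (f u)^-1.
  elim: u => [|c u [v vE]]; first by exists [::]; rewrite invg1.
  exists (v ++ [:: (~~ c.1, c.2)]).
  by rewrite fM vE /= mulg1 invgM; case: c => -[] i; rewrite /letter /= ?invgK.
have [K KE] : exists K : Subgroups G, carrier K = range f.
  apply: subgroup_of_set => [|_ _ [u _ <-] [v _ <-]]; first by exists [::].
  by have [w <-] := fV v; exists (u ++ w).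
have fT : range f = [set: G].
  apply/seteqP; split=> // g _; rewrite -KE.
  have : generated_by s g by rewrite sG.
  apply=> x xs; rewrite KE; exists [:: (false, index x s)] => //.
  by rewrite /f /letter /= nth_index // mulg1.
rewrite -fT; apply: card_le_trans (card_image_le _ _) _.
exact: countableP.
Qed.

(** LERF puts a finite index subgroup into every nonempty cylinder. *)
Lemma LERF_fin_gen_solitary (G : groupType) : fin_gen G -> LERF G -> solitary G.
Proof.
move=> fG lG; apply/solitaryP; split; first exact: fin_gen_countable.
move=> a b fa fb [K [aK bK]].
have [|L fL abL] := LERF_separate lG fa fb.
  by move=> x bx ax; apply: (bK x bx); apply: span_sub ax.
by exists L => //; apply: finite_index_isolated.
Qed.

(* Baire category by hand: enumerate Sub(G) and shrink cylinders so that the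
   n-th one avoids the n-th subgroup; the union of the increasing chain of
   positive parts generates a subgroup lying in all of them. *)
Lemma countable_Subgroups_solitary (G : groupType) : countable [set: G] ->
  countable [set: Subgroups G] -> solitary G.
Proof.
move=> cG /countable_injP[f finj]; apply/solitaryP; split=> //.
move=> a b fa fb abN0; apply: contrapT => noiso.
pose good (c : set G * set G) := [/\ finite_set c.1, finite_set c.2,
  cylinder c.1 c.2 !=set0, a `<=` c.1 & b `<=` c.2].
have step (x : (set G * set G) * nat) : exists d, good x.1 ->
    [/\ good d, x.1.1 `<=` d.1, x.1.2 `<=` d.2 &
        forall K, f K = x.2 -> ~ cylinder d.1 d.2 K].
  case: x => -[c1 c2] n /=; have [gc|] := pselect (good (c1, c2)); last by exists (c1, c2).
  have [[K fK cK]|noK] := pselect (exists2 K, f K = n & cylinder c1 c2 K); last first.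
    exists (c1, c2) => _; split=> // K fK cK; apply: noK; by exists K.
  have [fc1 fc2 cN0 ac bc] := gc.
  (* Otherwise [K] would be an isolated point of the original cylinder, against [noiso]. *)
  have [L cL LK] : exists2 L, cylinder c1 c2 L & L <> K.
    apply: contrapT => noL; apply: noiso; exists K.
      by case: cK => c1K c2K; split=> x ?; [apply: c1K; apply: ac | apply: c2K; apply: bc].
    exists c1, c2; split=> // L cL; apply: contrapT => LK; apply: noL; by exists L.
  have [g gLK] : exists g, carrier L g <> carrier K g.
    apply: contrapT => nog; apply: LK; apply: carrier_inj; apply: funext => g.
    apply: contrapT => ng; apply: nog; by exists g.
  have fU (A : set G) : finite_set A -> finite_set (A `|` [set g]).
    by move=> fA; rewrite finite_setU; split.
  case: cL => c1L c2L.
  have KU M : f M = n -> M = K by move=> fM; apply: finj; rewrite ?in_setT // fM.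
  (* A constraint at [g] is added that keeps [L] and expels [K], the only subgroup numbered [n]. *)
  have [Lg|nLg] := pselect (carrier L g).
    exists (c1 `|` [set g], c2) => _ /=.
    split; last 1 first.
    - move=> M /KU -> [c1K _]; apply: gLK; apply/propext; split=> // _.
      by apply: c1K; right.
    - split=> //=; first exact: fU.
        by exists L; split=> //; rewrite subUset; split=> // _ ->.
      by apply: subset_trans ac _; left.
    - by left.
    - by [].
  exists (c1, c2 `|` [set g]) => _ /=.
  split; last 1 first.
  - move=> M /KU -> [_ c2K]; apply: gLK; apply/propext; split=> // Kg.
    by case: (c2K g) => //; right.
  - split=> //=; first exact: fU.
      by exists L; split=> //; rewrite subUset; split=> // _ ->.
    by apply: subset_trans bc _; left.
  - by [].
  - by left.
have [F FP] := choice step.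
pose u := fix u n := if n is n'.+1 then F (u n', n') else (a, b).
have ugood n : good (u n).
  by elim: n => [|n IHn]; [split | case: (FP (u n, n))].
have uS n := FP (u n, n) (ugood n).
have umono m n : (m <= n)%N -> (u m).1 `<=` (u n).1 /\ (u m).2 `<=` (u n).2.
  elim: n => [|n IHn]; first by rewrite leqn0 => /eqP ->; split.
  rewrite leq_eqVlt => /orP[/eqP ->|/IHn[h1 h2]]; first by split.
  by case: (uS n) => _ h3 h4 _; split; [apply: subset_trans h3 | apply: subset_trans h4].
have spanS (c d : set G) : c `<=` d -> span c `<=` span d.
  by move=> cd x cx K dK; apply: cx; apply: subset_trans dK.
have [K KE] : exists K : Subgroups G, carrier K = \bigcup_n span (u n).1.
  apply: subgroup_of_set => [|x y [m _ mx] [n _ ny]].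
    by exists 0%N => //; have [K <-] := span_subgroup (u 0%N).1; apply: carrier1.
  exists (maxn m n) => //.
  have [K KE] := span_subgroup (u (maxn m n)).1; rewrite -KE.
  have [h1 _] := umono _ _ (leq_maxl m n); have [h2 _] := umono _ _ (leq_maxr m n).
  by apply: carrierF; rewrite KE; [apply: spanS mx | apply: spanS ny].
have Kcyl n : cylinder (u n).1 (u n).2 K.
  split; rewrite KE => x ux; first by exists n => //; apply: sub_span.
  move=> [m _ mx].
  have [h1 _] := umono _ _ (leq_maxl m n); have [_ h2] := umono _ _ (leq_maxr m n).
  have [_ _ [L [aL bL]] _ _] := ugood (maxn m n).
  by apply: (bL x); [apply: h2 | apply: span_sub aL _ _; apply: spanS mx].
(* The cylinder produced at step [f K] excludes [K] by construction. *)
by have [_ _ _ /(_ K erefl)] := uS (f K); apply; apply: (Kcyl (f K).+1).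
Qed.

(** The images of generators of [N] form a finite set that generates the kernel. *)
Lemma short_exact_solitary (N H G : groupType)
    (i : {multiplicative N -> H}) (p : {multiplicative H -> G}) :
  countable [set: G] -> short_exact i p -> fin_gen N -> solitary H -> solitary G.
Proof.
move=> cG [_ ip psurj] /fin_genP[a fa aN].
apply: (@solitary_quotient _ _ p (@gmulfM _ _ p) (i @` a)) => //.
- exact: finite_image.
- by move=> _ [x _ <-]; have : range i (i x) by [exists x]; rewrite ip.
move=> K aK x px.
have [n _ <-] : range i x by rewrite ip.
have [L LE] := preimage_subgroup (@gmulfM _ _ i) K.
have : carrier L n.
  have : span a n by rewrite aN.
  by apply=> y ay; rewrite LE; apply: aK; exists y.
by rewrite LE.
Qed.

(** * Right actions, stabilisers and finite models of actions *)

Section Actions.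
Variable G : groupType.

Definition right_action (Y : Type) (act : Y -> G -> Y) : Prop :=
  (forall y, act y 1 = y) /\ (forall y g h, act y (g * h) = act (act y g) h).

Definition trivial_act (Y : Type) (y : Y) (g : G) : Y := y.

Definition sum_act (Y Z : Type) (a : Y -> G -> Y) (b : Z -> G -> Z)
    (u : Y + Z) (g : G) : Y + Z :=
  match u with inl y => inl (a y g) | inr z => inr (b z g) end.

Lemma right_action_trivial Y : right_action (@trivial_act Y).
Proof. by []. Qed.

Lemma right_action_mul : right_action (fun g h : G => g * h).
Proof. by split=> [g|x g h]; rewrite ?mulg1 ?mulgA. Qed.

Lemma right_action_sum Y Z (a : Y -> G -> Y) (b : Z -> G -> Z) :
  right_action a -> right_action b -> right_action (sum_act a b).
Proof.
move=> [a1 aM] [b1 bM]; split=> [[y|z]|[y|z] g h] /=.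
- by rewrite a1.
- by rewrite b1.
- by rewrite aM.
- by rewrite bM.
Qed.

Lemma right_action_conj Y (s : Y -> Y) (a : Y -> G -> Y) : involutive s ->
  right_action a -> right_action (fun y g => s (a (s y) g)).
Proof. by move=> sK [a1 aM]; split=> [y|y g h]; rewrite ?a1 ?aM ?sK. Qed.

Section Orbits.
Variables (Y : Type) (act : Y -> G -> Y).
Hypothesis actP : right_action act.

Lemma actK y g : act (act y g) g^-1 = y.
Proof. by rewrite -actP.2 mulgV actP.1. Qed.

Lemma actKV y g : act (act y g^-1) g = y.
Proof. by rewrite -actP.2 mulVg actP.1. Qed.

Lemma act_fixJ y g h : act y (g * h / g) = y <-> act (act y g) h = act y g.
Proof.
rewrite !actP.2; split=> [fixy|->]; last exact: actK.
by rewrite -[RHS](congr1 (act^~ g) fixy) actKV.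
Qed.

Lemma stabiliser_subgroup y :
  exists K : Subgroups G, carrier K = [set g | act y g = y].
Proof.
apply: subgroup_of_set => [|g h /= yg yh]; first by rewrite /= actP.1.
by rewrite actP.2 yg -{1}yh actK.
Qed.

Lemma stabiliser_finite_index y (W : set Y) (K : Subgroups G) :
  finite_set W -> (forall g, W (act y g)) ->
  carrier K = [set g | act y g = y] -> finite_index K.
Proof.
(* The action is on the right but cosets are left ones: these are the fibres of the orbit map
   composed with inversion. *)
move=> fW Wy KE; apply: (@finite_index_fibres _ _ (fun g => act y g^-1)).
  by apply: sub_finite_set fW => _ [g _ <-].
by move=> g h ygh; rewrite KE /= actP.2 ygh actKV.
Qed.

End Orbits.

(** The point [K g] of the space of right cosets is encoded by the left coset [g^-1 K]. Acting on
    all subsets avoids a quotient type. *)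
Definition coset_act (A : set G) (g : G) : set G := [set g^-1 * k | k in A].

Lemma right_action_coset : right_action coset_act.
Proof.
split=> [A|A g h]; apply/seteqP; split=> x.
- by case=> k Ak <-; rewrite invg1 mul1g.
- by exists x; rewrite // invg1 mul1g.
- case=> k Ak <-; exists (g^-1 * k); first by exists k.
  by rewrite invgM mulgA.
- by case=> _ [k Ak <-] <-; exists k; rewrite // invgM mulgA.
Qed.

Lemma eq_coset_act (K : Subgroups G) g h :
  coset_act (carrier K) g = coset_act (carrier K) h <-> carrier K (g / h).
Proof. by have := eq_lcoset K g^-1 h^-1; rewrite invgK. Qed.

Lemma coset_act_fix (K : Subgroups G) g :
  coset_act (carrier K) g = carrier K <-> carrier K g.
Proof.
by have := eq_coset_act K g 1; rewrite (right_action_coset.1 (carrier K)) divg1.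
Qed.

(* The orbit of [i] is modelled on the cosets of a finite index subgroup [L i]
   that contains the finitely many elements of the stabiliser of [i] witnessing
   the required equalities, and none of those that would identify two points of [P]. *)
Lemma LERF_finite_model (X : choiceType) (act : X -> G -> X) (P : set X) (S : set G) (x0 : X) :
  right_action act -> LERF G -> finite_set P -> finite_set S ->
  exists (T : Type) (aT : T -> G -> T) (W : set T) (j : X -> T),
    [/\ right_action aT /\ finite_set W, forall t g, W t -> W (aT t g),
        forall p, P p -> W (j p), forall p q, P p -> P q -> j p = j q -> p = q &
        forall p s, P p -> S s -> P (act p s) -> aT (j p) s = j (act p s)].
Proof.
move=> actP lG fP fS.
pose orb p := [set q | exists g, p = act q g].
(* [r p] depends only on the orbit of [p]; below, [c p] leads from [r p] to [p]. *)
pose r p := xget x0 (orb p).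
have r_act p g : r (act p g) = r p.
  rewrite /r; congr xget; apply/seteqP; split=> q [h hE]; last first.
    by exists (h * g); rewrite actP.2 -hE.
  by exists (h / g); rewrite actP.2 -hE actK.
have rP p : exists g, p = act (r p) g.
  by apply: (@xgetPex _ x0 (orb p)); exists p, 1; rewrite actP.1.
have [c cP] := choice rP.
pose stab i := [set g | act i g = i].
have Lex i : exists L : Subgroups G, finite_index L /\
    cylinder ([set c p * s / c (act p s) | p in P & s in S] `&` stab i)
             ([set c p / c q | p in P & q in P] `\` stab i) L.
  have [K KE] := stabiliser_subgroup actP i.
  have [||| L fL abL] := @LERF_separate _ ([set c p * s / c (act p s) | p in P & s in S] `&` stab i)
             ([set c p / c q | p in P & q in P] `\` stab i) lG.
  - by apply: finite_setIl; apply: finite_image2.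
  - by apply: finite_setD; apply: finite_image2.
  - move=> x [_ nx] ax; apply: nx; rewrite -[stab i]KE.
    by apply: span_sub ax; rewrite KE => y [].
  by exists L.
have [L LP] := choice Lex.
(* The first component keeps different orbits apart. The second ranges over all subsets; [W] below
   cuts out a finite invariant part. *)
pose aT (t : X * set G) g := (t.1, coset_act t.2 g).
pose j p := (r p, coset_act (carrier (L (r p))) (c p)).
have aTP : right_action aT.
  split=> [[x A]|[x A] g h]; rewrite /aT /=.
    by rewrite right_action_coset.1.
  by rewrite right_action_coset.2.
pose W := \bigcup_(p in P) [set (r p, A) | A in [set lcoset (L (r p)) g | g in [set: G]]].
exists (X * set G)%type, aT, W, j; split.
- split=> //; apply: bigcup_finite => // p Pp; apply: finite_image.
  by case: (LP (r p)).
- move=> _ g [p Pp [_ [h _ <-] <-]]; exists p => //.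
  exists (coset_act (lcoset (L (r p)) h) g) => //; exists (g^-1 * h) => //.
  have := right_action_coset.2 (carrier (L (r p))) h^-1 g.
  by rewrite /coset_act invgM invgK.
- move=> p Pp; exists p => //; exists (coset_act (carrier (L (r p))) (c p)) => //.
- move=> p q Pp Pq [rpq]; rewrite rpq => /eq_coset_act Lpq; apply: contrapT => npq.
  have [_ [_ bL]] := LP (r q); apply: bL Lpq; split; first by exists p => //; exists q.
  rewrite /stab /= actP.2 => /(congr1 (act^~ (c q))) /=.
  by rewrite actKV // -[in X in X -> _]rpq -[in X in X -> _]cP rpq -cP.
- move=> p s Pp Ss Pps; rewrite /aT /j /= r_act -right_action_coset.2.
  congr pair; apply/eq_coset_act.
  have [_ [aL _]] := LP (r p); apply: aL; split; first by exists p => //; exists s.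
  have cps := cP (act p s); rewrite r_act in cps.
  by rewrite /stab /= !actP.2 -cP [X in act X _]cps actK.
Qed.

End Actions.

(** * Coproducts characterised by their actions, and paths in such actions *)

Definition letter_val (G H F : groupType) (i : G -> F) (j : H -> F) (l : G + H) : F :=
  match l with inl g => i g | inr h => j h end.

Definition word_val (G H F : groupType) (i : G -> F) (j : H -> F) (s : seq (G + H)) : F :=
  foldr (fun l w => letter_val i j l * w) 1 s.

(* [F] is the coproduct of [G] and [H], phrased so that it can be used with
   actions on arbitrary (infinite) types and is symmetric in the two factors. *)
Definition is_coproduct (G H F : groupType) (i : G -> F) (j : H -> F) : Prop :=
  [/\ {morph i : x y / x * y}, {morph j : x y / x * y},
      forall w, exists s, word_val i j s = w &
      forall (Y : Type) (a : Y -> G -> Y) (b : Y -> H -> Y),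
        right_action a -> right_action b -> exists act : Y -> F -> Y,
        [/\ right_action act, forall y g, act y (i g) = a y g &
            forall y h, act y (j h) = b y h]].

Lemma is_coproduct_sym (G H F : groupType) (i : G -> F) (j : H -> F) :
  is_coproduct i j -> is_coproduct j i.
Proof.
move=> [iM jM gen ext]; split=> // [w|Y a b aP bP]; last first.
  by have [act [actP ? ?]] := ext Y b a bP aP; exists act.
have [s <-] := gen w.
exists (map (fun l => match l with inl g => inr g | inr h => inl h end) s).
by elim: s => //= -[g|h] s ->.
Qed.

(** Reduced words act letter by letter; by [step_push], merging or cancelling letters does not
    change the result. *)
Lemma free_product_coproduct (G H : groupType) :
  is_coproduct (fun g : G => @fp_letter G H (inl g)) (fun h : H => @fp_letter G H (inr h)).
Proof.
split; [exact: (fp_letterM G H).1 | exact: (fp_letterM G H).2 | move=> [w rw]|].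
  exists w; elim: w rw => [|l w IHw] rw; first exact: val_inj.
  by rewrite fp_cons -IHw /=; case: l rw.
move=> Y a b [a1 aM] [b1 bM].
pose step y (l : G + H) := match l with inl g => a y g | inr h => b y h end.
have step_push l w y : foldl step y (push l w) = foldl step (step y l) w.
  rewrite /push; case: ifP => [|_]; first by case: l => c /= /eqP ->; rewrite ?a1 ?b1.
  by case: l w => c [|[] d w] //=; case: ifP => [/eqP cd|_] /=;
    rewrite -?aM -?bM // cd ?a1 ?b1.
exists (fun y w => foldl step y (fp_word w)); split=> [|y g|y h]; last 2 first.
- by rewrite /= step_push.
- by rewrite /= step_push.
split=> // y [u ru] [v rv] /=; elim: u y {ru} => //= l u IHu y.
by rewrite step_push IHu.
Qed.

Section Coproduct.
Variables (G H F : groupType) (i : G -> F) (j : H -> F).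
Hypothesis cop : is_coproduct i j.
Local Notation letter := (letter_val i j).
Local Notation eval := (word_val i j).

Let iM : {morph i : x y / x * y}. Proof. by case: cop. Qed.
Let jM : {morph j : x y / x * y}. Proof. by case: cop. Qed.

Lemma coproduct_ind (P : F -> Prop) :
  P 1 -> (forall l w, P w -> P (letter l * w)) -> forall w, P w.
Proof.
have [_ _ gen _] := cop; move=> P1 PM w; have [s <-] := gen w.
by elim: s => //= l s; apply: PM.
Qed.

Lemma coproduct_invariant (Y : Type) (act : Y -> F -> Y) (W : set Y) :
  right_action act -> (forall y l, W y -> W (act y (letter l))) ->
  forall y w, W y -> W (act y w).
Proof.
move=> actP Wl y w; move: w y; apply: coproduct_ind => [y|l w IHw y Wy].
  by rewrite actP.1.
by rewrite actP.2; apply/IHw/Wl.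
Qed.

(** Let [G] act on itself by right multiplication and [H] trivially. The resulting action of [F]
    commutes with left multiplications, so the orbit map of [1] is a morphism. *)
Lemma coproduct_retract : exists p : F -> G,
  [/\ {morph p : x y / x * y}, forall g, p (i g) = g & forall h, p (j h) = 1].
Proof.
have [_ _ _ ext] := cop.
have [act [actP ai aj]] := ext _ _ _ (right_action_mul G) (right_action_trivial H G).
have equiv x y w : act (x * y) w = x * act y w.
  move: w y; apply: coproduct_ind => [y|l w IHw y]; first by rewrite !actP.1.
  by rewrite !actP.2 -IHw; case: l => c /=; rewrite ?ai ?aj ?mulgA.
exists (act 1); split=> [x y|g|h]; rewrite ?ai ?aj ?mul1g //.
by rewrite actP.2 -[X in act X _]mulg1 equiv.
Qed.

Lemma coproduct_fin_gen : fin_gen G -> fin_gen H -> fin_gen F.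
Proof.
move=> /fin_genP[a fa aG] /fin_genP[b fb bH]; apply/fin_genP.
exists (i @` a `|` j @` b); first by rewrite finite_setU; split; apply: finite_image.
apply/seteqP; split=> // w _ K; rewrite /= subUset => -[aK bK].
have [L LE] := preimage_subgroup iM K; have [M ME] := preimage_subgroup jM K.
have LT g : carrier K (i g).
  have : span a g by rewrite aG.
  by move=> /(_ L); rewrite /= LE; apply=> x ax; apply: aK; exists x.
have MT h : carrier K (j h).
  have : span b h by rewrite bH.
  by move=> /(_ M); rewrite /= ME; apply=> x bx; apply: bK; exists x.
move: w; apply: coproduct_ind => [|[g|h] w Kw]; first exact: carrier1.
  exact: carrierM (LT g) Kw.
exact: carrierM (MT h) Kw.
Qed.

Lemma coproduct_trivial_surj : trivial_group H -> range i = [set: F].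
Proof.
move=> H1; apply/seteqP; split=> // w _; move: w.
apply: coproduct_ind => [|[g|h] w [x _ <-]]; first by exists 1; rewrite ?(morph_one iM).
  by exists (g * x); rewrite ?iM.
by exists x => //=; rewrite (H1 h) (morph_one jM) mul1g.
Qed.

(** The map [i] and its retraction are then bijective, so [solitary_quotient] applies in both
    directions with [n] empty. *)
Lemma coproduct_trivial_solitary : countable [set: G] -> trivial_group H ->
  solitary F <-> solitary G.
Proof.
move=> cG H1; have isurj := coproduct_trivial_surj H1.
have [p [pM pi pj]] := coproduct_retract.
have psurj : range p = [set: G] by apply/seteqP; split=> // g _; exists (i g).
split; [apply: (@solitary_quotient _ _ p pM set0) => // K _ w|
        apply: (@solitary_quotient _ _ i iM set0) => // [|K _ g ig]].
- have [g _ <-] : range i w by rewrite isurj.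
  by rewrite pi => ->; rewrite (morph_one iM); apply: carrier1.
- rewrite -isurj; exact: card_le_trans (card_image_le _ _) cG.
- rewrite -[g]pi ig (morph_one pM); exact: carrier1.
Qed.

Section Visited.
Variables (X : Type) (act : X -> F -> X).
Hypothesis actP : right_action act.

Fixpoint visited (x : X) (s : seq (G + H)) : set X :=
  if s is l :: s' then x |` visited (act x (letter l)) s' else [set x].

Lemma finite_visited x s : finite_set (visited x s).
Proof.
elim: s x => [|l s IHs] x /=; first exact: finite_set1.
by rewrite finite_setU; split=> //; apply: finite_set1.
Qed.

Lemma visited_start x s : visited x s x.
Proof. by case: s => [|l s] //=; left. Qed.

Lemma visited_end x s : visited x s (act x (eval s)).
Proof.
elim: s x => [|l s IHs] x /=; first by rewrite actP.1.
by rewrite actP.2; right.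
Qed.

(** Serves to compare the action on cosets with perturbed or finite ones: agreement on single edges
    inside [P] passes to paths by induction. *)
Lemma trace_visited (Y : Type) (act' : Y -> F -> Y) (k : X -> Y) (P : set X) x s :
  right_action act' ->
  (forall p l, l \in s -> P p -> P (act p (letter l)) ->
     act' (k p) (letter l) = k (act p (letter l))) ->
  visited x s `<=` P -> act' (k x) (eval s) = k (act x (eval s)).
Proof.
move=> act'P; elim: s x => [|l s IHs] x kP /=; first by rewrite act'P.1 actP.1.
rewrite subUset => -[Px sP]; rewrite act'P.2 actP.2 kP ?mem_head //.
- by apply: IHs => // p m ms; apply: kP; rewrite inE ms orbT.
- exact: Px.
- by apply: sP; apply: visited_start.
Qed.

(** The word is cut at the first letter that leads out of [P]. *)
Lemma first_exit (P : set X) x : P x -> (exists w, ~ P (act x w)) ->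
  exists s l, visited x s `<=` P /\ ~ P (act x (eval s * letter l)).
Proof.
have [_ _ gen _] := cop.
move=> Px [w]; have [t <-] := gen w; elim: t x Px => [|l t IHt] x Px /=.
  by rewrite actP.1.
rewrite actP.2; have [Pl|nPl] := pselect (P (act x (letter l))); last first.
  by exists [::], l; split; [move=> y -> | rewrite mul1g].
move=> /(IHt _ Pl)[s [m [sP nP]]]; exists (l :: s), m; split=> /=.
  by rewrite subUset; split=> // y ->.
by rewrite -mulgA actP.2.
Qed.

End Visited.
End Coproduct.

(** * Gluing and perturbing actions by an involution *)

(** Conjugation by [s] transplants an action from one copy of [P] to the other. Injectivity on [P]
    makes the relation [R] functional, and its symmetry makes [s] an involution. *)
Lemma swap_involution (X T1 T2 : Type) (P : set X) (j1 : X -> T1) (j2 : X -> T2) :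
  (forall p q, P p -> P q -> j1 p = j1 q -> p = q) ->
  (forall p q, P p -> P q -> j2 p = j2 q -> p = q) ->
  exists s : T1 + T2 -> T1 + T2, [/\ involutive s,
    forall p, P p -> s (inl (j1 p)) = inr (j2 p),
    forall t, ~ (j1 @` P) t -> s (inl t) = inl t &
    forall t, ~ (j2 @` P) t -> s (inr t) = inr t].
Proof.
move=> inj1 inj2.
pose R (u v : T1 + T2) :=
  (exists2 p, P p & (u = inl (j1 p) /\ v = inr (j2 p)) \/
                    (u = inr (j2 p) /\ v = inl (j1 p))) \/
  [/\ u = v, forall p, P p -> u <> inl (j1 p) & forall p, P p -> u <> inr (j2 p)].
have Rex u : exists v, R u v.
  have [[p [Pp up]]|nu] := pselect (exists p, P p /\ (u = inl (j1 p) \/ u = inr (j2 p))).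
    by case: up => ->; [exists (inr (j2 p)) | exists (inl (j1 p))]; left; exists p; auto.
  by exists u; right; split=> // p Pp up; apply: nu; exists p; auto.
have Rsym u v : R u v -> R v u.
  move=> [[p Pp uv]|[<- n1 n2]]; last by right.
  by left; exists p => //; case: uv => -[-> ->]; auto.
have Rfun u v v' : R u v -> R u v' -> v = v'.
  move=> [[p Pp uv]|[<- n1 n2]] [[q Pq uv']|[<- n1' n2']] //.
  - case: uv uv' => -[-> ->] [] [] // [] pq ->.
      by rewrite (inj1 _ _ Pp Pq pq).
    by rewrite (inj2 _ _ Pp Pq pq).
  - by case: uv => -[uE _]; [case: (n1' p) | case: (n2' p)].
  - by case: uv' => -[uE _]; [case: (n1 q) | case: (n2 q)].
have [s sR] := choice Rex.
exists s; split=> [u|p Pp|t nt|t nt]; apply: (Rfun _ _ _ (sR _)).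
- exact: Rsym.
- by left; exists p => //; left.
- by right; split=> // p Pp [tp]; apply: nt; exists p.
- by right; split=> // p Pp [tp]; apply: nt; exists p.
Qed.

Section CoproductSubgroups.
Variables (G H F : groupType) (i : G -> F) (j : H -> F).
Hypothesis cop : is_coproduct i j.
Local Notation eval := (word_val i j).

(* Swapping the point [q = x0 * w * i g] with the point [z0] of an arbitrary
   [H]-set [Z] changes the [H]-action at [q] but not along the visited points. *)
Lemma perturbed_action (K : Subgroups F) (a b : set F) (P : set (set F)) :
  cylinder a b K -> (forall L, cylinder a b L -> L = K) ->
  (forall x, (a `|` b) x -> exists2 s, eval s = x &
     visited i j (@coset_act F) (carrier K) s `<=` P) ->
  forall s g, visited i j (@coset_act F) (carrier K) s `<=` P ->
  ~ P (coset_act (carrier K) (eval s * i g)) ->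
  forall (Z : Type) (aZ : Z -> H -> Z) (z0 : Z) (h : H), right_action aZ ->
  carrier K ((eval s * i g) * j h / (eval s * i g)) <-> aZ z0 h = z0.
Proof.
move=> [aK bK] abE abP s g sP; set v := eval s * i g; move=> nPq Z aZ z0 h aZP.
have [iM jM _ ext] := cop; have cosetP := right_action_coset F.
set x0 := carrier K in abP sP nPq *; set q := coset_act x0 v in nPq.
(* With [unit] as the glued set, [sg] is the transposition of [q] and [z0]. *)
have [sg [sgK sg1 sgl sgr]] := @swap_involution unit (set F) Z setT (fun=> q) (fun=> z0)
  (fun p p' _ _ _ => match p, p' with tt, tt => erefl end)
  (fun p p' _ _ _ => match p, p' with tt, tt => erefl end).
have sgq : sg (inl q) = inr z0 := sg1 tt I.
have sgP A : A <> q -> sg (inl A) = inl A.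
  by move=> Aq; apply: sgl => -[_ _ /esym].
pose aG := sum_act (fun A g => coset_act A (i g)) (@trivial_act G Z).
pose aH y h := sg (sum_act (fun A h => coset_act A (j h)) aZ (sg y) h).
have comp (E : groupType) (f : E -> F) : {morph f : x y / x * y} ->
    right_action (fun A x => coset_act A (f x)).
  by move=> fM; split=> [A|A x y]; rewrite ?(morph_one fM) ?fM ?cosetP.1 ?cosetP.2.
have aGP : right_action aG.
  by apply: right_action_sum; [apply: comp | apply: right_action_trivial].
have aHP : right_action aH.
  by apply: right_action_conj => //; apply: right_action_sum => //; apply: comp.
have [act [actP acti actj]] := ext _ _ _ aGP aHP.
(* Edges inside [P] neither start nor end at [q], so the transposition does not affect them. *)
have trace t : visited i j (@coset_act F) x0 t `<=` P ->
    act (inl x0) (eval t) = inl (coset_act x0 (eval t)).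
  apply: (trace_visited cosetP actP) => p [g'|h'] _ Pp Pp' /=; first by rewrite acti.
  have pq A : P A -> A <> q by move=> PA Aq; apply: nPq; rewrite -Aq.
  by rewrite actj /aH sgP /= ?sgP //; apply: pq.
have [L LE] := stabiliser_subgroup actP (inl x0).
have LK : L = K.
  apply: abE; split=> x abx; rewrite LE /=.
    have [t tx tP] := abP x (or_introl abx).
    by rewrite -tx trace // tx (coset_act_fix K _).2 //; apply: aK.
  have [t tx tP] := abP x (or_intror abx).
  rewrite -tx trace // tx => -[/coset_act_fix]; exact: bK.
(* The last edge, which does end at [q], has a letter of [G], whose action is not perturbed. *)
have actv : act (inl x0) v = inl q.
  by rewrite actP.2 trace // acti /= -cosetP.2.
have sgz0 : sg (inr z0) = inl q by rewrite -sgq sgK.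
rewrite /x0 -LK LE /= (act_fixJ actP) actv actj /aH sgq /=.
by split=> [|-> //]; rewrite -sgz0 => /(can_inj sgK)[].
Qed.

Lemma first_exit_left_absurd (K : Subgroups F) (a b : set F) (P : set (set F)) :
  cylinder a b K -> (forall L, cylinder a b L -> L = K) ->
  (forall x, (a `|` b) x -> exists2 s, eval s = x &
     visited i j (@coset_act F) (carrier K) s `<=` P) ->
  forall s g, visited i j (@coset_act F) (carrier K) s `<=` P ->
  ~ P (coset_act (carrier K) (eval s * i g)) -> trivial_group H.
Proof.
move=> abK abE abP s g sP nPq h.
have perturb := perturbed_action abK abE abP sP nPq.
(* A fixed point puts the conjugate of [h] into [K]; the regular [H]-set then forces [h] to be
   trivial. *)
have Kh := (perturb _ _ tt h (right_action_trivial H unit)).2 erefl.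
have := (perturb _ _ 1 h (right_action_mul H)).1 Kh.
by rewrite mul1g.
Qed.

End CoproductSubgroups.

(** * Isolated subgroups, solitude and LERF for coproducts *)

Section CoproductMain.
Variables (G H F : groupType) (i : G -> F) (j : H -> F).
Hypothesis cop : is_coproduct i j.
Local Notation eval := (word_val i j).

Lemma word_val_swap s :
  word_val j i (map (fun l => match l with inl g => inr g | inr h => inl h end) s) = eval s.
Proof. by elim: s => //= -[g|h] s ->. Qed.

Lemma visited_swap (X : Type) (act : X -> F -> X) x s :
  visited j i act x (map (fun l => match l with inl g => inr g | inr h => inl h end) s) =
  visited i j act x s.
Proof. by elim: s x => //= -[g|h] s IHs x /=; rewrite IHs. Qed.

Lemma finite_words (a : set F) (X : Type) (act : X -> F -> X) x : finite_set a ->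
  exists P : set X, exists D : set (G + H), [/\ finite_set P, finite_set D &
    forall y, a y -> exists s, [/\ eval s = y, [set` s] `<=` D & visited i j act x s `<=` P]].
Proof.
have [_ _ gen _] := cop; have [w wP] := choice gen => fa.
exists (\bigcup_(y in a) visited i j act x (w y)), (\bigcup_(y in a) [set` w y]).
split; [apply: bigcup_finite => // y _; exact: finite_visited |
        apply: bigcup_finite => // y _; exact: finite_seq |].
by move=> y ay; exists (w y); split=> // t ?; exists y.
Qed.

Lemma coproduct_isolated_finite_index (K : Subgroups F) :
  ~ trivial_group G -> ~ trivial_group H -> cyl_isolated K -> finite_index K.
Proof.
move=> nG nH [a [b [fa fb abK abE]]].
have fab : finite_set (a `|` b) by rewrite finite_setU.
have cosetP := right_action_coset F.
have [P0 [D [fP0 _ abP0]]] := finite_words (@coset_act F) (carrier K) fab.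
(* The base point must belong to [P] for [first_exit], even when [a] and [b] are empty. *)
pose P := P0 `|` [set carrier K].
have fP : finite_set P by rewrite finite_setU; split=> //; apply: finite_set1.
have abP x : (a `|` b) x -> exists2 s, eval s = x &
    visited i j (@coset_act F) (carrier K) s `<=` P.
  by move=> /abP0[s [sx _ sP]]; exists s => // A /sP; left.
have PK : P (carrier K) by right.
have KE : carrier K = [set g | coset_act (carrier K) g = carrier K].
  by apply/seteqP; split=> g /coset_act_fix.
have [Pall|/existsNP nP] := pselect (forall g, P (coset_act (carrier K) g)).
  exact: (stabiliser_finite_index cosetP fP Pall KE).
have [s [[g|h] [sP nPl]]] := first_exit cop cosetP PK nP.
  by case: nH; apply: (first_exit_left_absurd cop abK abE abP sP nPl).
(* The exit edge carries a letter of [H]: the factors exchange roles. *)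
case: nG; move: nPl; rewrite -word_val_swap => nPl.
rewrite -visited_swap in sP.
apply: (first_exit_left_absurd (is_coproduct_sym cop) abK abE _ sP nPl).
move=> x /abP[t tx tP].
exists (map (fun l => match l with inl g => inr g | inr h => inl h end) t).
  by rewrite word_val_swap.
by rewrite visited_swap.
Qed.

Lemma coproduct_solitary_left : ~ trivial_group G -> ~ trivial_group H ->
  solitary F -> LERF G /\ fin_gen G.
Proof.
move=> nG nH /solitaryP[_ dF]; have [iM _ _ _] := cop.
have [p [pM pi _]] := coproduct_retract cop.
have psurj : range p = [set: G] by apply/seteqP; split=> // g _; exists (i g).
split; last first.
  (* The cylinder without constraints yields an isolated subgroup. It is finitely generated and of
     finite index, so [F] and its quotient [G] are finitely generated. *)
  have [|K _ isoK] := dF _ _ (finite_set0 F) (finite_set0 F).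
    by have [K KE] := span_subgroup (set0 : set F); exists K; split; apply: sub0set.
  have fK := coproduct_isolated_finite_index nG nH isoK.
  have [a fa Ka] := cyl_isolated_fin_gen isoK.
  exact: (fin_gen_image pM psurj (fin_gen_of_finite_index fK fa Ka)).
apply: LERF_of_separate => a g fa nag.
have [A AE] := span_subgroup a; have [B BE] := image_subgroup iM A.
have iinj : injective i by apply: can_inj pi.
(* As [i] is injective, the image of [span a] avoids [i g], so this cylinder is nonempty. *)
have [|K [aK bK] isoK] := dF _ _ (finite_image i fa) (finite_set1 (i g)).
  exists B; split; rewrite BE.
    by move=> _ [x ax <-]; exists x => //; rewrite AE; apply: sub_span.
  by move=> _ -> [x Ax /iinj xg]; apply: nag; rewrite -AE -xg.
have fK := coproduct_isolated_finite_index nG nH isoK.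
have [L LE] := preimage_subgroup iM K.
exists L; split.
- apply: (@finite_index_fibres _ _ (fun x => lcoset K (i x))).
    by apply: sub_finite_set fK => _ [x _ <-]; exists (i x).
  by move=> x y /eq_lcoset; rewrite LE /preimage /= iM (morph_inv iM).
- by move=> x ax; rewrite LE; apply: aK; exists x.
- by rewrite LE; apply: bK.
Qed.

(* Burns and Romanovskii: the finitely many points visited by the words for
   [a] and [g] embed into a finite [G]-set and into a finite [H]-set, which are
   glued along them. *)
Lemma LERF_coproduct : LERF G -> LERF H -> LERF F.
Proof.
move=> lG lH; have [iM jM gen ext] := cop; have cosetP := right_action_coset F.
apply: LERF_of_separate => a g fa nag.
have [K KE] := span_subgroup a; set x0 := carrier K in KE.
have fag : finite_set (a `|` [set g]).
  by rewrite finite_setU; split=> //; apply: finite_set1.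
have [P [D [fP fD agP]]] := finite_words (@coset_act F) x0 fag.
have [sg [sgg sgD sgP]] := agP g (or_intror erefl).
have Px0 : P x0 by apply: sgP; apply: visited_start.
have Pg : P (coset_act x0 g) by apply: sgP; rewrite -sgg; apply: visited_end.
have comp (E : groupType) (f : E -> F) : {morph f : x y / x * y} ->
    right_action (fun A x => coset_act A (f x)).
  by move=> fM; split=> [A|A x y]; rewrite ?(morph_one fM) ?fM ?cosetP.1 ?cosetP.2.
have fDl : finite_set (inl @^-1` D : set G) by apply: finite_preimage => // x y _ _ [].
have fDr : finite_set (inr @^-1` D : set H) by apply: finite_preimage => // x y _ _ [].
have [T1 [a1 [W1 [j1 [[a1P fW1] W1a W1P inj1 j1P]]]]] :=
  LERF_finite_model x0 (comp _ _ iM) lG fP fDl.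
have [T2 [a2 [W2 [j2 [[a2P fW2] W2a W2P inj2 j2P]]]]] :=
  LERF_finite_model x0 (comp _ _ jM) lH fP fDr.
have [s [sK s1 sl sr]] := swap_involution inj1 inj2.
(* [G] acts through [T1]; [H] acts through [T2], conjugated by [s] so as to reach the copy of [P] in
   [T1]. *)
pose aG := sum_act a1 (@trivial_act G T2).
pose aH y h := s (sum_act (@trivial_act H T1) a2 (s y) h).
have aGP : right_action aG.
  by apply: right_action_sum => //; apply: right_action_trivial.
have aHP : right_action aH.
  by apply: right_action_conj => //; apply: right_action_sum => //; apply: right_action_trivial.
have [act [actP acti actj]] := ext _ _ _ aGP aHP.
pose W (y : T1 + T2) := match y with inl t => W1 t | inr t => W2 t end.
have fW : finite_set W.
  apply: (@sub_finite_set _ _ (inl @` W1 `|` inr @` W2)).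
    by move=> [t|t] Wt; [left | right]; exists t.
  by rewrite finite_setU; split; apply: finite_image.
have Ws y : W y -> W (s y).
  have s2 p : P p -> s (inr (j2 p)) = inl (j1 p) by move=> Pp; rewrite -s1 // sK.
  case: y => t Wt.
    have [[p Pp <-]|nt] := pselect ((j1 @` P) t); last by rewrite sl.
    by rewrite s1 //; apply: W2P.
  have [[p Pp <-]|nt] := pselect ((j2 @` P) t); last by rewrite sr.
  by rewrite s2 //; apply: W1P.
have Wact y w : W y -> W (act y w).
  apply: (coproduct_invariant cop actP) => {}y [x|x] Wy /=; rewrite ?acti ?actj.
    by case: y Wy => t Wt //=; apply: W1a.
  by have := Ws _ Wy; rewrite /aH => Wsy; apply: Ws; move: Wsy; case: (s y) => t Wt //=; apply: W2a.
have trace t : [set` t] `<=` D -> visited i j (@coset_act F) x0 t `<=` P ->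
    act (inl (j1 x0)) (eval t) = inl (j1 (coset_act x0 (eval t))).
  move=> tD; apply: (trace_visited (k := fun A => inl (j1 A)) cosetP actP).
  move=> p [x|x] /tD Dx Pp Ppx /=; first by rewrite acti /= j1P.
  by rewrite actj /aH s1 //= j2P // -s1 // sK.
have [L LE] := stabiliser_subgroup actP (inl (j1 x0)).
exists L; split.
- apply: (stabiliser_finite_index actP fW _ LE) => w.
  by apply: Wact; apply: W1P.
- move=> x ax; rewrite LE /=; have [t [tx tD tP]] := agP x (or_introl ax).
  rewrite -tx trace // tx (coset_act_fix K _).2 // -/x0 KE; exact: sub_span.
(* [x0] and its translate by [g] both lie in [P], where [j1] is injective; they differ because [g]
   is not in [span a]. *)
- rewrite LE /= -sgg trace // sgg => -[/inj1 x0g].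
  by apply: nag; rewrite -KE; apply/coset_act_fix; apply: x0g.
Qed.

End CoproductMain.

(** * Assembly of the four statements *)

Theorem theorem1p7 :
  [/\ (forall G : groupType, fin_gen G -> LERF G -> solitary G),
      (forall G : groupType, countable [set: G] ->
         countable [set: Subgroups G] -> solitary G),
      (forall (N H G : groupType)
         (i : {multiplicative N -> H}) (p : {multiplicative H -> G}),
         countable [set: N] -> countable [set: H] -> countable [set: G] ->
         short_exact i p -> fin_gen N -> solitary H -> solitary G) &
      (forall G H : groupType, countable [set: G] -> countable [set: H] ->
         (solitary (free_product G H) <->
            ((LERF G /\ fin_gen G) /\ (LERF H /\ fin_gen H)) \/
            ((solitary G /\ trivial_group H) \/
             (solitary H /\ trivial_group G))))].
Proof.
split; first exact: LERF_fin_gen_solitary.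
- exact: countable_Subgroups_solitary.
- by move=> N H G i p _ _; apply: short_exact_solitary.
move=> G H cG cH; have cop := free_product_coproduct G H.
have cop' := is_coproduct_sym cop.
split=> [sF|[[[lG fG] [lH fH]]|[[sG H1]|[sH G1]]]].
- have [H1|nH] := pselect (trivial_group H).
    by right; left; split=> //; apply/(coproduct_trivial_solitary cop).
  have [G1|nG] := pselect (trivial_group G).
    by right; right; split=> //; apply/(coproduct_trivial_solitary cop').
  left; split; first exact: (coproduct_solitary_left cop nG nH sF).
  exact: (coproduct_solitary_left cop' nH nG sF).
- apply: LERF_fin_gen_solitary; first exact: coproduct_fin_gen cop fG fH.
  exact: LERF_coproduct cop lG lH.
- exact/(coproduct_trivial_solitary cop).
- exact/(coproduct_trivial_solitary cop').
Qed.
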